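(* Let $E$ be a finite subset of $\mathbb{N}^2$ such that $(0,0),(0,1),(1,0),(1,1)\notin E$ and $\{(2,0),(0,2)\}\not\subset E$. Assume that $E_k\subset E$ for some integer $k>1$, where $$E_k=\{(0,k+1),(k+1,0),(k,k)\}.$$ Let $\underline{\alpha}=(\alpha_{i,j})_{(i,j)\in E}\in\mathbb{C}^{\operatorname{Card}(E)}$ be a vector whose coordinates are algebraically independent over $\mathbb{Q}$. Then $R_{\underline{\alpha}}(x)$ is not a $D$-finite power series. In particular it is not an algebraic power series.
   Context: Monomial orders: given a linear form $\lambda$ on $\mathbb{R}^2$ with positive coefficients, the monomial order induced by $\lambda$ on $\mathbb{N}^2$ is $\alpha\leq\beta$ iff $(\lambda(\alpha),\alpha_1,\alpha_2)\leq_{lex}(\lambda(\beta),\beta_1,\beta_2)$. For a vector $\underline{a}=(a_{i,j})_{(i,j)\in E}$ with entries in a field $\Bbbk$, set $g_{\underline{a}}(x,y)=xy-\sum_{(i,j)\in E}a_{i,j}x^iy^j$. Under the conditions on $E$ there is a monomial order induced by such a linear form for which $(1,1)$ is smaller than every element of $E$, so that $xy$ is the initial (smallest non-zero) term of $g_{\underline{a}}$; fix such an order. The Grauert-Hironaka-Galligo division of $xy$ by $g_{\underline{a}}$ then gives unique formal power series $Q_{\underline{a}}$ and remainder $r$ with $xy=g_{\underline{a}}Q_{\underline{a}}+r$, where no monomial of $r$ is divisible by $xy$; the remainder is written $r=R_{\underline{a}}(x)+S_{\underline{a}}(y)$ with $R_{\underline{a}}(x)\in\Bbbk[[x]]$,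 $S_{\underline{a}}(y)\in\Bbbk[[y]]$ (both without constant term). $R_{\underline{\alpha}}$ is this series for $\Bbbk=\mathbb{C}$ and $\underline{a}=\underline{\alpha}$. A power series $f\in\Bbbk[[x]]$ in one variable over a field $\Bbbk$ of characteristic zero is $D$-finite if there exist $D\in\mathbb{N}$ and $a_0,\dots,a_D\in\Bbbk[x]$, not all zero, with $a_Df^{(D)}+a_{D-1}f^{(D-1)}+\cdots+a_0f=0$. It is algebraic if $P(x,f(x))=0$ for some non-zero $P\in\Bbbk[x,T]$. *)

(* Defs.v *)
From mathcomp Require Import all_boot all_order all_algebra finmap.
From mathcomp Require Import mpoly boolp.
From mathcomp Require Import zify.
From Stdlib Require Import ClassicalEpsilon.

Set Implicit Arguments.
Unset Strict Implicit.
Unset Printing Implicit Defensive.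

Import GRing.Theory.
Local Open Scope ring_scope.

(** [f n] is the coefficient of [x^n]. *)
Definition fps (K : Type) := nat -> K.

Definition fps_one (K : fieldType) : fps K := fun n => (n == 0)%:R.

Definition fps_mul (K : fieldType) (f g : fps K) : fps K :=
  fun n => \sum_(i < n.+1) f i * g (n - i)%N.

Definition fps_exp (K : fieldType) (f : fps K) (m : nat) : fps K :=
  iter m (fps_mul f) (fps_one K).

Definition fps_deriv (K : fieldType) (f : fps K) : fps K :=
  fun n => f n.+1 *+ n.+1.

Definition fps_of_poly (K : fieldType) (p : {poly K}) : fps K := fun n => p`_n.

Definition dfinite (K : fieldType) (f : fps K) : Prop :=
  exists (D : nat) (a : 'I_D.+1 -> {poly K}),
    (exists i, a i != 0) /\
    forall n, \sum_(i < D.+1)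
                fps_mul (fps_of_poly (a i)) (iter i (@fps_deriv K) f) n = 0.

(** [P : {poly {poly K}}] is a polynomial in [T] with coefficients in [K[x]]. *)
Definition algebraic_fps (K : fieldType) (f : fps K) : Prop :=
  exists2 P : {poly {poly K}}, P != 0 &
    forall n, \sum_(j < size P) fps_mul (fps_of_poly P`_j) (fps_exp f j) n = 0.

(** [f i j] is the coefficient of [x^i y^j]. *)
Definition fps2 (K : Type) := nat -> nat -> K.

Definition mono2 (K : fieldType) (u v : nat) : fps2 K :=
  fun i j => ((i == u) && (j == v))%:R.

Definition fps2_mul (K : fieldType) (f g : fps2 K) : fps2 K :=
  fun i j => \sum_(i1 < i.+1) \sum_(j1 < j.+1)
               f i1 j1 * g (i - i1)%N (j - j1)%N.

Definition admissible (E : {fset nat * nat}) : Prop :=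
  [/\ (0, 0)%N \notin E, (0, 1)%N \notin E, (1, 0)%N \notin E, (1, 1)%N \notin E
    & ~~ ([fset (2, 0)%N; (0, 2)%N] `<=` E)%fset].

Definition gser (K : fieldType) (E : {fset nat * nat}) (a : E -> K) : fps2 K :=
  fun i j => mono2 K 1 1 i j
             - \sum_(e : E) a e * mono2 K (fsval e).1 (fsval e).2 i j.

(** Division of [xy] by [gser a] in the sense of Grauert-Hironaka-Galligo.  The
    monomial order enters only through the initial monomial of [gser a], which
    is [xy] for the order induced by the linear form of [admissible_weight]. *)
Definition xy_division (K : fieldType) (E : {fset nat * nat}) (a : E -> K)
    (qr : fps2 K * fps2 K) : Prop :=
  (forall i j, mono2 K 1 1 i j = fps2_mul (gser a) qr.1 i j + qr.2 i j) /\
  (forall i j, (1 <= i)%N -> (1 <= j)%N -> qr.2 i j = 0).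

(** The quotient and remainder; they are characterised by [xy_quoremP] and
    [xy_division_unique] below when [E] is admissible, and are arbitrary
    otherwise. *)
Definition xy_quorem (K : fieldType) (E : {fset nat * nat}) (a : E -> K) :
    fps2 K * fps2 K :=
  epsilon (inhabits (mono2 K 0 0, mono2 K 0 0)) (xy_division a).

(** The remainder is [Rser a] in [x] plus [Sser a] in [y]; neither has a
    constant term, see [xy_quorem_split]. *)
Definition Rser (K : fieldType) (E : {fset nat * nat}) (a : E -> K) : fps K :=
  fun i => (xy_quorem a).2 i 0%N.

Definition Sser (K : fieldType) (E : {fset nat * nat}) (a : E -> K) : fps K :=
  fun j => (xy_quorem a).2 0%N j.

Definition Ek (k : nat) : {fset nat * nat} :=
  [fset (0, k.+1)%N; (k.+1, 0)%N; (k, k)]%fset.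

Definition alg_independent_Q (L : fieldType) (T : finType) (a : T -> L) : Prop :=
  forall P : {mpoly rat[#|T|]},
    (map_mpoly ratr P).@[fun i => a (enum_val i)] = 0 -> P = 0.

Section Division.
Variables (K : fieldType) (E : {fset nat * nat}).
Implicit Types (a : E -> K) (q r : fps2 K).

(** A linear form for which [(1, 1)] is strictly smaller than all of [E]. *)
Lemma admissible_weight : admissible E ->
  exists w : nat * nat, [/\ (0 < w.1)%N, (0 < w.2)%N &
    forall e, e \in E -> (w.1 + w.2 < w.1 * e.1 + w.2 * e.2)%N].
Proof.
case=> h00 h01 h10 h11 h2.
have gen (w : nat * nat) : (0 < w.1)%N -> (0 < w.2)%N ->
    (w.1 < w.2.*2)%N -> (w.2 < w.1.*2)%N ->
    ((2, 0)%N \in E -> (w.2 < w.1)%N) -> ((0, 2)%N \in E -> (w.1 < w.2)%N) ->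
    forall e, e \in E -> (w.1 + w.2 < w.1 * e.1 + w.2 * e.2)%N.
  case: w => u v /= u0 v0 uv vu h20 h02 [i j] eE /=.
  case: i eE => [|[|[|i]]] eE.
  - case: j eE => [|[|[|j]]] eE; rewrite ?eE // in h00 h01 h02 *.
    + by have := h02 isT; lia.
    + nia.
  - case: j eE => [|[|j]] eE; rewrite ?eE // in h10 h11 *; nia.
  - case: j eE => [|j] eE; last nia.
    by have := h20 eE; lia.
  - nia.
have [h20|h20] := boolP ((2, 0)%N \in E).
  exists (3, 2)%N; split=> //; apply: gen => //= h02.
  by case/negP: h2; apply/fsubsetP => e; rewrite !inE => /orP[] /eqP->.
have [h02|h02] := boolP ((0, 2)%N \in E).
  by exists (2, 3)%N; split=> //; apply: gen => //= h; rewrite h in h20.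
by exists (1, 1)%N; split=> //; apply: gen => //= h; rewrite h in h20 h02.
Qed.

Lemma fps2_mul_mono u v q i j :
  fps2_mul (mono2 K u v) q i j =
    if (u <= i)%N && (v <= j)%N then q (i - u)%N (j - v)%N else 0.
Proof.
rewrite /fps2_mul /mono2; case: ifP => [/andP[ui vj]|uv].
  rewrite (bigD1 (Ordinal (ui : (u < i.+1)%N))) //= [X in _ + X]big1 ?addr0.
    rewrite (bigD1 (Ordinal (vj : (v < j.+1)%N))) //= [X in _ + X]big1 ?addr0.
      by rewrite !eqxx mul1r.
    move=> j1 /negP j1v; rewrite eqxx /=; case: eqP => [e|_]; last by rewrite mul0r.
    by case: j1v; apply/eqP/val_inj.
  move=> i1 /negP i1u; rewrite big1 // => j1 _.
  case: eqP => [e|_]; last by rewrite mul0r.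
  by case: i1u; apply/eqP/val_inj.
rewrite big1 // => i1 _; rewrite big1 // => j1 _.
case: eqP => [e1|_]; last by rewrite mul0r.
case: eqP => [e2|_]; last by rewrite mul0r.
by move: uv; rewrite -e1 -e2 !leq_ord.
Qed.

Definition gstep a q i j :=
  \sum_(e : E) a e *
    (if ((fsval e).1 <= i)%N && ((fsval e).2 <= j)%N
     then q (i - (fsval e).1)%N (j - (fsval e).2)%N else 0).

Lemma fps2_mul_gser a q i j :
  fps2_mul (gser a) q i j =
    (if (1 <= i)%N && (1 <= j)%N then q (i - 1)%N (j - 1)%N else 0)
    - gstep a q i j.
Proof.
have -> : gstep a q i j = \sum_(e : E) \sum_(i1 < i.+1)
    a e * \sum_(j1 < j.+1)
      mono2 K (fsval e).1 (fsval e).2 i1 j1 * q (i - i1)%N (j - j1)%N.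
  by apply: eq_bigr => e _; rewrite -fps2_mul_mono -mulr_sumr.
rewrite -fps2_mul_mono /fps2_mul /gser.
rewrite [X in _ = _ - X]exchange_big /= -sumrB; apply: eq_bigr => i1 _.
under [X in _ = _ - X]eq_bigr => e _ do rewrite mulr_sumr.
rewrite [X in _ = _ - X]exchange_big /= -sumrB; apply: eq_bigr => j1 _.
rewrite mulrBl mulr_suml; congr (_ - _).
by apply: eq_bigr => e _; rewrite mulrA.
Qed.

Lemma gstep_local a w q q' i j :
  (0 < w.1)%N -> (0 < w.2)%N ->
  (forall e, e \in E -> (w.1 + w.2 < w.1 * e.1 + w.2 * e.2)%N) ->
  (forall i' j', (w.1 * i' + w.2 * j' < w.1 * i + w.2 * j)%N ->
     q i' j' = q' i' j') ->
  gstep a q i.+1 j.+1 = gstep a q' i.+1 j.+1.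
Proof.
move=> w1 w2 hw eqq; apply: eq_bigr => e _; case: ifP => // /andP[le1 le2].
congr (_ * _); apply: eqq; have := hw _ (fsvalP e).
move: (fsval e).1 (fsval e).2 le1 le2 => u v le1 le2.
rewrite !mulnBr !mulnS; move: (leq_mul (leqnn w.1) le1).
by move: (leq_mul (leqnn w.2) le2); rewrite !mulnS; lia.
Qed.

Fixpoint gquo a n : fps2 K :=
  if n is m.+1 then fun i j => mono2 K 0 0 i j + gstep a (gquo a m) i.+1 j.+1
  else fun _ _ => 0.

Lemma xy_division_exists a : admissible E -> exists qr, xy_division a qr.
Proof.
move=> /admissible_weight[w [w1 w2 hw]].
have stab n n' i j : (w.1 * i + w.2 * j < n)%N -> (w.1 * i + w.2 * j < n')%N ->
    gquo a n i j = gquo a n' i j.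
  elim: n n' i j => [|n IHn] [|n'] i j //= hn hn'; congr (_ + _).
  by apply: (gstep_local _ w1 w2 hw) => i' j' lt; apply: IHn; lia.
pose q : fps2 K := fun i j => gquo a (w.1 * i + w.2 * j).+1 i j.
exists (q, fun i j => mono2 K 1 1 i j - fps2_mul (gser a) q i j).
split=> [i j|[|i] [|j] //= _ _]; first by rewrite addrC subrK.
rewrite fps2_mul_gser /= !subn1 /= {1}/q /=.
rewrite (@gstep_local a w (gquo a (w.1 * i + w.2 * j)) q) ?addrK //.
  by rewrite /mono2 !eqSS subrr.
by move=> i' j' lt; apply: stab; lia.
Qed.

Lemma xy_division_unique a qr qr' : admissible E ->
  xy_division a qr -> xy_division a qr' -> qr = qr'.
Proof.
move=> /admissible_weight[w [w1 w2 hw]].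
case: qr qr' => [q r] [q' r'] [/= eq0 r0] [/= eq0' r0'].
have qrec (p s : fps2 K) :
    (forall i j, mono2 K 1 1 i j = fps2_mul (gser a) p i j + s i j) ->
    (forall i j, (1 <= i)%N -> (1 <= j)%N -> s i j = 0) ->
    forall i j, p i j = mono2 K 1 1 i.+1 j.+1 + gstep a p i.+1 j.+1.
  move=> h h0 i j; rewrite h h0 // addr0 fps2_mul_gser /= !subn1 /=.
  by rewrite subrK.
have eqq : q = q'.
  apply: funext => i; apply: funext => j.
  have [n] := ubnP (w.1 * i + w.2 * j)%N.
  elim: n i j => // n IHn i j lt.
  rewrite (qrec _ _ eq0 r0) (qrec _ _ eq0' r0'); congr (_ + _).
  by apply: (gstep_local _ w1 w2 hw) => i' j' lt'; apply: IHn; lia.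
congr (_, _) => //; apply: funext => i; apply: funext => j.
apply: (addrI (fps2_mul (gser a) q i j)).
by rewrite -eq0 {1}eqq -eq0'.
Qed.

Lemma xy_quoremP a : admissible E -> xy_division a (xy_quorem a).
Proof. by move=> adm; apply: epsilon_spec; apply: xy_division_exists. Qed.

Lemma xy_quorem_split a : admissible E ->
  [/\ Rser a 0%N = 0, Sser a 0%N = 0 &
    forall i j, (xy_quorem a).2 i j =
      (if j == 0%N then Rser a i else 0) + (if i == 0%N then Sser a j else 0)].
Proof.
move=> adm; have [eq0 r0] := xy_quoremP a adm.
have r00 : (xy_quorem a).2 0%N 0%N = 0.
  have := eq0 0%N 0%N; rewrite fps2_mul_gser /= /mono2 /= sub0r.
  rewrite /gstep big1 ?oppr0 ?add0r // => e _.
  case: ifP => [|_]; last by rewrite mulr0.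
  rewrite !leqn0 => /andP[/eqP e1 /eqP e2]; case: adm => /negP[].
  by have := fsvalP e; rewrite [fsval e]surjective_pairing e1 e2.
split=> // i j; rewrite /Rser /Sser.
case: i j => [|i] [|j] /=; rewrite ?addr0 ?add0r ?r00 ?addr0 //.
exact: r0.
Qed.

End Division.

(* Main.v *)
Require Import Defs.
From mathcomp Require Import all_boot all_order all_algebra finmap.
From mathcomp Require Import mpoly boolp zify.
From mathcomp Require Import reals complex.

(** The coefficients of [Rser a] are polynomials in [a] with rational
    coefficients. A differential or algebraic equation of bounded shape amounts
    to the vanishing of all maximal minors of an infinite matrix whose entries
    are such polynomials, so by algebraic independence an equation for
    [Rser alpha] yields one of the same shape for [Rser b], for every [b]. Take
    [b] with [g_b = (x - y^k)(y - x^k)], the example of Kashiwara and Gabber: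
    restricting the division to the two branches gives
    [R(x) + R(x^k) = x^(k+1)], so [R] is the lacunary series
    [sum_m (-1)^m x^((k+1) k^m)]. Its gaps exclude a linear recurrence with
    polynomial coefficients. If [P] were of minimal degree in [T] with
    [P(x, R) = 0], then [P(x^k, x^(k+1) - T)] would be proportional to [P], and
    comparing the subleading coefficients would give a rational solution of
    the functional equation, which degrees exclude. *)

Set Implicit Arguments.
Unset Strict Implicit.
Unset Printing Implicit Defensive.

Import GRing.Theory Num.Theory.
Local Open Scope ring_scope.
Local Open Scope complex_scope.

(** * Functions of the coefficient vector given by rational polynomials *)

Definition ratpolyfun (K : numFieldType) (T : finType) (g : (T -> K) -> K) :=
  exists P : {mpoly rat[#|T|]},
    forall a, g a = (map_mpoly ratr P).@[fun i => a (enum_val i)].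

Section RationalPolynomialFunctions.
Variables (K : numFieldType) (T : finType).
Implicit Types (g h : (T -> K) -> K) (a : T -> K).

Lemma ratpolyfun_ext g h : g =1 h -> ratpolyfun g -> ratpolyfun h.
Proof. by move=> gh [P gP]; exists P => a; rewrite -gh. Qed.

Lemma ratpolyfun_ratr (c : rat) : ratpolyfun (fun _ : T -> K => ratr c).
Proof. by exists c%:MP => a; rewrite map_mpolyC /= mevalC. Qed.

Lemma ratpolyfun_nat (n : nat) : ratpolyfun (fun _ : T -> K => n%:R).
Proof.
by apply: ratpolyfun_ext (ratpolyfun_ratr n%:R) => a; rewrite ratr_nat.
Qed.

Lemma ratpolyfun_var t : ratpolyfun (fun a : T -> K => a t).
Proof.
by exists 'X_(enum_rank t) => a; rewrite map_mpolyX mevalXU enum_rankK.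
Qed.

Lemma ratpolyfunD g h :
  ratpolyfun g -> ratpolyfun h -> ratpolyfun (fun a => g a + h a).
Proof.
by move=> [P gP] [Q hQ]; exists (P + Q) => a; rewrite rmorphD /= mevalD gP hQ.
Qed.

Lemma ratpolyfunM g h :
  ratpolyfun g -> ratpolyfun h -> ratpolyfun (fun a => g a * h a).
Proof.
by move=> [P gP] [Q hQ]; exists (P * Q) => a; rewrite rmorphM /= mevalM gP hQ.
Qed.

Lemma ratpolyfun_sum (I : Type) (r : seq I) (F : I -> (T -> K) -> K) :
  (forall i, ratpolyfun (F i)) -> ratpolyfun (fun a => \sum_(i <- r) F i a).
Proof.
move=> polyF; elim: r => [|i r IHr].
  by apply: ratpolyfun_ext (ratpolyfun_nat 0) => a; rewrite big_nil.
apply: ratpolyfun_ext (ratpolyfunD (polyF i) IHr) => a.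
by rewrite big_cons.
Qed.

Lemma ratpolyfun_prod (I : Type) (r : seq I) (F : I -> (T -> K) -> K) :
  (forall i, ratpolyfun (F i)) -> ratpolyfun (fun a => \prod_(i <- r) F i a).
Proof.
move=> polyF; elim: r => [|i r IHr].
  by apply: ratpolyfun_ext (ratpolyfun_nat 1) => a; rewrite big_nil.
apply: ratpolyfun_ext (ratpolyfunM (polyF i) IHr) => a.
by rewrite big_cons.
Qed.

Lemma ratpolyfun_det (m : nat) (A : (T -> K) -> 'M[K]_m) :
  (forall i j, ratpolyfun (fun a => A a i j)) -> ratpolyfun (fun a => \det (A a)).
Proof.
move=> polyA; apply: ratpolyfun_sum => s; apply: ratpolyfunM.
  apply: ratpolyfun_ext (ratpolyfun_ratr ((-1) ^+ perm.odd_perm s)) => a.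
  by rewrite rmorphXn /= rmorphN1.
by apply: ratpolyfun_prod => i; apply: polyA.
Qed.

(** Independence turns vanishing at the single point [alpha] into vanishing of the representing
    polynomial, hence of the function everywhere. *)
Lemma ratpolyfun_alg_independent g (alpha : T -> K) :
  alg_independent_Q alpha -> ratpolyfun g -> g alpha = 0 -> forall a, g a = 0.
Proof.
by move=> indep [P gP]; rewrite gP => /indep P0 a; rewrite gP P0 !rmorph0.
Qed.

End RationalPolynomialFunctions.

Lemma ratpolyfun_fps_exp (K : numFieldType) (T : finType)
    (f : (T -> K) -> fps K) j n :
  (forall m, ratpolyfun (fun a => f a m)) ->
  ratpolyfun (fun a => fps_exp (f a) j n).
Proof.
move=> polyf; elim: j n => [|j IHj] n; first exact: ratpolyfun_nat.
by apply: ratpolyfun_sum => i; apply: ratpolyfunM.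
Qed.

(** * Linear dependence and its specialization *)

(** The ranks of the finite truncations are at most [m], so some [M N] has maximal rank and its row
    space contains every [r n]. A vector killed by [M N] is then killed by all rows, hence zero; so
    [M N] has full column rank and [m] of its rows form an invertible matrix. *)
Lemma exists_minor_neq0 (F : fieldType) (m : nat) (r : nat -> 'rV[F]_m) :
  (forall u : 'cV_m, (forall n, r n *m u = 0) -> u = 0) ->
  exists h : 'I_m -> nat, \det (\matrix_(i, j) r (h i) 0 j) != 0.
Proof.
move=> inj; pose M N := \matrix_(i < N) r i.
have M_le N N' : (N <= N')%N -> (M N <= M N')%MS.
  move=> le; apply/row_subP => i; apply: submx_trans (row_sub (widen_ord le i) _).
  by rewrite !rowK.
have exr : exists d, `[< exists N, \rank (M N) = d >].
  by exists (\rank (M 0%N)); apply/asboolP; exists 0%N.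
have ubr d : `[< exists N, \rank (M N) = d >] -> (d <= m)%N.
  by case/asboolP=> N <-; apply: rank_leq_col.
have [d /= /asboolP[N rN] dmax] := ex_maxnP exr ubr.
have rM n : (r n <= M N)%MS.
  have MM : (M (maxn N n.+1) <= M N)%MS.
    have le := M_le _ _ (leq_maxl N n.+1).
    rewrite -(mxrank_leqif_sup le) eqn_leq mxrankS //= rN.
    by apply: dmax; apply/asboolP; eexists.
  apply: submx_trans MM.
  apply: submx_trans (row_sub (Ordinal (leq_maxr N n.+1 : n < _)%N) _).
  by rewrite rowK.
have full : row_full (M N).
  rewrite -cokermx_eq0; apply/eqP/matrixP => i j.
  transitivity (col j (cokermx (M N)) i 0); first by rewrite [RHS]mxE.
  rewrite (inj (col j (cokermx (M N)))) => [|n]; first by rewrite !mxE.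
  have /submxP[D ->] := rM n.
  by rewrite colE mulmxA -(mulmxA D) mulmx_coker mulmx0 mul0mx.
exists (fun i => fullrankfun full i); have := fullrowsub_unit full.
rewrite unitmxE unitfE; congr (\det _ != 0).
by apply/matrixP => i j; rewrite !mxE.
Qed.

(* A nonvanishing maximal minor at [b] forces a nonvanishing one at [alpha]. *)
Lemma dependence_specialization (K : numFieldType) (T I : finType)
    (G : (T -> K) -> nat -> I -> K) (alpha b : T -> K) :
  alg_independent_Q alpha ->
  (forall n i, ratpolyfun (fun a => G a n i)) ->
  (exists2 u : I -> K, (exists i, u i != 0) & forall n, \sum_i G alpha n i * u i = 0) ->
  exists2 u : I -> K, (exists i, u i != 0) & forall n, \sum_i G b n i * u i = 0.
Proof.
move=> indep polyG [u [i0 ui0] Gu]; apply: contrapT => noU.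
pose r a n : 'rV[K]_#|I| := \row_j G a n (enum_val j).
have rE a n (v : 'cV_#|I|) :
    (r a n *m v) 0 0 = \sum_i G a n i * v (enum_rank i) 0.
  rewrite mxE (reindex (@enum_rank I)) /=; last first.
    by apply: onW_bij; apply: enum_rank_bij.
  by apply: eq_bigr => i _; rewrite mxE enum_rankK.
have [v rv|h /negP[]] := @exists_minor_neq0 K #|I| (r b).
  apply/eqP; apply: contrapT => v0; apply: noU.
  exists (fun i => v (enum_rank i) 0) => [|n]; last by rewrite -rE rv mxE.
  apply: contrapT => v0'; apply: v0; apply/eqP/matrixP => i j.
  rewrite ord1 mxE; apply/eqP; apply: contrapT => /negP vi.
  by apply: v0'; exists (enum_val i); rewrite enum_valK.
apply/eqP.
have polyA i j : ratpolyfun (fun a => (\matrix_(i, j) r a (h i) 0 j) i j).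
  apply: ratpolyfun_ext (polyG (h i) (enum_val j)) => a.
  by rewrite !mxE.
apply: (ratpolyfun_alg_independent indep (ratpolyfun_det polyA)).
set A := (\matrix_(i, j) _).
(* At [alpha] the same rows annihilate the non-zero vector [u], so [A] cannot be invertible. *)
have [|AU] := eqVneq (\det A) 0; first by [].
have : A *m (\col_j u (enum_val j)) = 0.
  apply/matrixP => i j; rewrite ord1.
  transitivity ((r alpha (h i) *m (\col_j u (enum_val j))) 0 0).
    by rewrite !mxE; apply: eq_bigr => l _; rewrite !mxE.
  by rewrite rE mxE -[RHS](Gu (h i)); apply: eq_bigr => l _; rewrite mxE enum_rankK.
move/(congr1 (mulmx (invmx A))); rewrite mulKmx ?unitmxE ?unitfE // mulmx0.
move/matrixP/(_ (enum_rank i0) 0); rewrite !mxE enum_rankK => u0.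
by rewrite u0 eqxx in ui0.
Qed.

Lemma big_ord_widen0 (V : nmodType) (F : nat -> V) (n m : nat) :
  (n <= m)%N -> (forall i, (n <= i)%N -> F i = 0) ->
  \sum_(i < m) F i = \sum_(i < n) F i.
Proof.
move=> nm F0; rewrite -!(big_mkord xpredT F) (big_cat_nat (leq0n n) nm) //=.
by rewrite [X in _ + X]big_nat_cond [X in _ + X]big1 ?addr0 // => i /andP[/andP[/F0]].
Qed.

Lemma fps_mul_poly (K : fieldType) (p : {poly K}) (f : fps K) (d n : nat) :
  (size p <= d)%N ->
  fps_mul (fps_of_poly p) f n =
    \sum_(l < d) p`_l * (if (l <= n)%N then f (n - l)%N else 0).
Proof.
move=> pd; rewrite /fps_mul /fps_of_poly.
pose F l := p`_l * (if (l <= n)%N then f (n - l)%N else 0).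
transitivity (\sum_(l < n.+1) F l).
  by apply: eq_bigr => l _; rewrite /F -ltnS ltn_ord.
rewrite -(@big_ord_widen0 _ F n.+1 (n.+1 + d)) ?leq_addr //; last first.
  by move=> l nl; rewrite /F leqNgt nl mulr0.
rewrite (@big_ord_widen0 _ F d) ?leq_addl // => l dl.
by rewrite /F nth_default ?mul0r // (leq_trans pd).
Qed.

(** Dependence over the polynomial ring: taking iterated derivatives for [B] gives D-finiteness,
    taking powers gives algebraicity. *)
Definition poly_dependent (K : fieldType) (D : nat) (B : 'I_D -> fps K) :=
  exists2 a : 'I_D -> {poly K}, (exists i, a i != 0) &
    forall n, \sum_(i < D) fps_mul (fps_of_poly (a i)) (B i) n = 0.

Lemma poly_dependent_specialization (K : numFieldType) (T : finType) (D : nat)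
    (B : (T -> K) -> 'I_D -> fps K) (alpha b : T -> K) :
  alg_independent_Q alpha ->
  (forall i n, ratpolyfun (fun a => B a i n)) ->
  poly_dependent (B alpha) -> poly_dependent (B b).
Proof.
move=> indep polyB [a [i0 ai0] aB].
(* With all degrees below [d], the relation is a linear system in finitely many unknowns, the
   coefficients of the [a i], indexed by pairs. *)
pose d := (\max_(i < D) size (a i))%N.
have ad i : (size (a i) <= d)%N by apply: leq_bigmax.
pose G c n (il : 'I_D * 'I_d) : K :=
  if (il.2 <= n)%N then B c il.1 (n - il.2)%N else 0.
have polyG n il : ratpolyfun (fun c => G c n il).
  rewrite /G; case: (_ <= _)%N => //.
  exact: (ratpolyfun_nat _ _ 0).
have [|u [[i l] uil] Gu] := @dependence_specialization K T _ G alpha b indep polyG.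
  exists (fun il : 'I_D * 'I_d => (a il.1)`_il.2) => [|n].
    have lt : ((size (a i0)).-1 < d)%N.
      by apply: leq_trans (ad i0); rewrite prednK // lt0n size_poly_eq0.
    by exists (i0, Ordinal lt); rewrite /= -lead_coefE lead_coef_eq0.
  rewrite -[RHS](aB n) -(pair_bigA _ (fun i l => G alpha n (i, l) * (a i)`_l)) /=.
  by apply: eq_bigr => i _; rewrite (fps_mul_poly _ _ (ad i)); apply: eq_bigr => l _; rewrite mulrC.
(* The default 0 is never reached, since [l < d] makes [insub] succeed. *)
pose p i := \poly_(l < d) oapp (fun l' : 'I_d => u (i, l')) 0 (insub l).
have pE i' (l' : 'I_d) : (p i')`_l' = u (i', l').
  by rewrite coef_poly ltn_ord valK.
exists p => [|n].
  by exists i; apply: contraNneq uil => pi0; rewrite -pE pi0 coef0.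
transitivity (\sum_i' \sum_l' G b n (i', l') * u (i', l')); last first.
  by rewrite pair_bigA -[RHS](Gu n); apply: eq_bigr => -[].
apply: eq_bigr => i' _; rewrite (fps_mul_poly _ _ (size_poly _ _)).
by apply: eq_bigr => l' _; rewrite pE mulrC.
Qed.

(** * Polynomial dependence of quotient and remainder on the coefficients *)

Section Remainder.
Variables (K : numFieldType) (E : {fset nat * nat}).
Hypothesis admE : admissible E.
Implicit Types (a : E -> K).

Lemma ratpolyfun_gstep (q : (E -> K) -> fps2 K) i j :
  (forall e : E, ((fsval e).1 <= i)%N -> ((fsval e).2 <= j)%N ->
     ratpolyfun (fun a => q a (i - (fsval e).1)%N (j - (fsval e).2)%N)) ->
  ratpolyfun (fun a => gstep a (q a) i j).
Proof.
move=> polyq; apply: ratpolyfun_sum => e; apply: ratpolyfunM.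
  exact: ratpolyfun_var.
case: (boolP (((fsval e).1 <= i)%N && ((fsval e).2 <= j)%N)) => [/andP[le1 le2]|_].
  exact: polyq.
exact: (ratpolyfun_nat _ _ 0).
Qed.

Lemma xy_quorem1E a i j :
  (xy_quorem a).1 i j = mono2 K 0 0 i j + gstep a (xy_quorem a).1 i.+1 j.+1.
Proof.
have [/(_ i.+1 j.+1) + /(_ i.+1 j.+1) r0] := xy_quoremP a admE.
by rewrite r0 // addr0 fps2_mul_gser /= !subn1 /= /mono2 !eqSS => ->; rewrite subrK.
Qed.

(** Induction on the weight of [(i, j)]: exponents in [E] weigh more than [(1, 1)], so the recursion
    calls only quotient coefficients of smaller weight. *)
Lemma ratpolyfun_quo i j : ratpolyfun (fun a => (xy_quorem a).1 i j).
Proof.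
have [w [w1 w2 wE]] := admissible_weight admE.
have [n] := ubnP (w.1 * i + w.2 * j)%N; elim: n i j => // n IHn i j lt.
apply: (@ratpolyfun_ext _ _
  (fun a => mono2 K 0 0 i j + gstep a (xy_quorem a).1 i.+1 j.+1)) => [a|].
  by rewrite -xy_quorem1E.
apply: ratpolyfunD; first exact: ratpolyfun_nat.
apply: ratpolyfun_gstep => e le1 le2; apply: IHn.
have := wE _ (fsvalP e); move: (fsval e).1 (fsval e).2 le1 le2 => u v le1 le2.
rewrite !mulnBr !mulnS; move: (leq_mul (leqnn w.1) le1).
by move: (leq_mul (leqnn w.2) le2); rewrite !mulnS; lia.
Qed.

(** On the axis [j = 0] neither [xy] nor [xy] times the quotient contributes, so the remainder
    equals the [gstep] term there. *)
Lemma ratpolyfun_Rser n : ratpolyfun (fun a => Rser a n).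
Proof.
have gquoP : ratpolyfun (fun a => gstep a (xy_quorem a).1 n 0).
  by apply: ratpolyfun_gstep => e _ _; apply: ratpolyfun_quo.
apply: ratpolyfun_ext gquoP => a; rewrite /Rser.
have [/(_ n 0%N) + _] := xy_quoremP a admE.
rewrite fps2_mul_gser /mono2 /= !andbF sub0r => /eqP.
by rewrite eq_sym addrC subr_eq0 => /eqP.
Qed.

End Remainder.

(** * Restriction to the curve [y = x^k] *)

(** The product of [q] with the monomial [x^u y^v]. *)
Definition shift2 (K : fieldType) (u v : nat) (q : fps2 K) : fps2 K :=
  fun i j => if (u <= i)%N && (v <= j)%N then q (i - u)%N (j - v)%N else 0.

(* The coefficient of [x^n] in [h(x, x^k)]. *)
Definition line_sum (K : fieldType) (k n : nat) (h : fps2 K) : K :=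
  \sum_(j < n.+1) if (k * j <= n)%N then h (n - k * j)%N j else 0.

Section LineSum.
Variables (K : fieldType) (k : nat).
Hypothesis k_gt0 : (0 < k)%N.
Implicit Types (q h : fps2 K).

Lemma line_sumD n h1 h2 :
  line_sum k n (fun i j => h1 i j + h2 i j) = line_sum k n h1 + line_sum k n h2.
Proof.
by rewrite /line_sum -big_split; apply: eq_bigr => j _; case: ifP => _ /=; rewrite ?addr0.
Qed.

Lemma line_sumN n h : line_sum k n (fun i j => - h i j) = - line_sum k n h.
Proof.
by rewrite /line_sum -sumrN; apply: eq_bigr => j _; case: ifP => _ /=; rewrite ?oppr0.
Qed.

(** Substituting [y = x^k] turns the factor [x^u y^v] into [x^(u + k v)]. *)
Lemma line_sum_shift u v n q :
  line_sum k n (shift2 u v q) =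
    if (u + k * v <= n)%N then line_sum k (n - (u + k * v)) q else 0.
Proof.
rewrite /line_sum /shift2; case: ifP => [le|gt]; last first.
  rewrite big1 // => j _; case: ifP => // kj; case: ifP => // /andP[h1 h2].
  suff : (u + k * v <= n)%N by rewrite gt.
  by move: (leq_mul (leqnn k) h2); lia.
set m := (n - (u + k * v))%N.
have kv : (v <= k * v)%N by rewrite leq_pmull.
pose F j := if (k * j <= n)%N then
   if (u <= n - k * j)%N && (v <= j)%N then q (n - k * j - u)%N (j - v)%N else 0 else 0.
pose H j := if (k * j <= m)%N then q (m - k * j)%N j else 0.
have vn : (v <= n.+1)%N by lia.
rewrite -(big_mkord xpredT F) (big_cat_nat (leq0n v) vn) //= big_nat_cond big1 ?add0r; last first.
  by move=> j /andP[/andP[_ jv] _]; rewrite /F [(v <= j)%N]leqNgt jv andbF; case: ifP.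
rewrite -{1}(add0n v) big_addn big_mkord.
rewrite -[RHS](@big_ord_widen0 _ H m.+1 (n.+1 - v)); last first.
- by move=> j mj; rewrite /H leqNgt (leq_trans mj) // leq_pmull.
- by rewrite /m; lia.
apply: eq_bigr => j _; rewrite /F /H addnK leq_addl andbT mulnDr /m.
by do 3?[case: ifP => ?] => //; try lia; congr (q _ _); lia.
Qed.

Lemma line_sum_mono n :
  line_sum k n (mono2 K 1 1) = (n == k.+1)%:R.
Proof.
rewrite /line_sum /mono2; have [->|nk] := eqVneq n k.+1.
  rewrite (bigD1 (inord 1)) //= inordK ?ltnS // muln1 leqnSn subSnn /= big1 ?addr0 //.
  move=> j; case: ifP => // _ j1; case: (eqVneq (j : nat) 1%N) j1 => [j1|]; last by rewrite andbF.
  by case/eqP; apply: val_inj; rewrite /= inordK.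
rewrite big1 // => j _; case: ifP => // le; case: eqP => // e1; case: eqP => // e2.
by case/eqP: nk; rewrite e2 in e1 le; lia.
Qed.

(** The restriction of [f(x) + g(y)] is [f(x) + g(x^k)]. *)
Lemma line_sum_axes n (f g : fps K) :
  line_sum k n (fun i j => (if j == 0%N then f i else 0) + (if i == 0%N then g j else 0))
  = f n + (if (k %| n)%N then g (n %/ k)%N else 0).
Proof.
rewrite line_sumD; congr (_ + _); rewrite /line_sum.
  by rewrite big_ord_recl /= muln0 subn0 big1 ?addr0 // => j _; case: ifP.
case: ifP => [/dvdnP[m ->]|kn].
  rewrite mulnK // (bigD1 (inord m)) //= inordK ?ltnS ?leq_pmulr //.
  rewrite mulnC leqnn subnn /= big1 ?addr0 // => j jm; case: ifP => // le.
  case: eqP => // e; case/eqP: jm; apply: val_inj.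
  rewrite /= inordK ?ltnS ?leq_pmulr //.
  by apply/eqP; rewrite -(eqn_pmul2l k_gt0); lia.
rewrite big1 // => j _; case: ifP => // le; case: eqP => // e.
suff : (k %| n)%N by rewrite kn.
by apply/dvdnP; exists j; lia.
Qed.

(* [(x - y^k)(y - x^k)] vanishes on the curve [y = x^k], so the quotient disappears. *)
Lemma division_on_curve q (f g : fps K) :
  (forall i j, mono2 K 1 1 i j =
     shift2 1 1 q i j - shift2 k.+1 0 q i j - shift2 0 k.+1 q i j + shift2 k k q i j
     + ((if j == 0%N then f i else 0) + (if i == 0%N then g j else 0))) ->
  forall n, f n + (if (k %| n)%N then g (n %/ k)%N else 0) = (n == k.+1)%:R.
Proof.
move=> qfg n; rewrite -line_sum_mono -line_sum_axes.
(* On the curve [xy] and [x^(k+1)] agree, and so do [y^(k+1)] and [x^k y^k], so the four terms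
   cancel in pairs. *)
have line0 : line_sum k n (fun i j =>
    shift2 1 1 q i j - shift2 k.+1 0 q i j - shift2 0 k.+1 q i j + shift2 k k q i j) = 0.
  rewrite !line_sumD !line_sumN !line_sum_shift.
  by rewrite muln1 muln0 addn0 add0n mulnS add1n subrr add0r addNr.
rewrite -[LHS]add0r -[X in X + _]line0 -line_sumD.
by apply: eq_bigr => j _; case: ifP => // _; rewrite qfg.
Qed.

End LineSum.

(** * The remainder for [(x - y^k)(y - x^k)] *)

Section Specialization.
Variables (K : numFieldType) (E : {fset nat * nat}) (k : nat).
Hypotheses (admE : admissible E) (k_gt1 : (1 < k)%N) (EkE : (Ek k `<=` E)%fset).

(* [gser curve_coef] is [(x - y^k) (y - x^k)]. *)
Definition curve_coef (e : E) : K :=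
  (fsval e == (k.+1, 0)%N)%:R + (fsval e == (0, k.+1)%N)%:R - (fsval e == (k, k))%:R.

Lemma sum_fset_delta (F : nat * nat -> K) x :
  x \in E -> \sum_(e : E) (fsval e == x)%:R * F (fsval e) = F x.
Proof.
move=> xE; rewrite (bigD1 [` xE]%fset) //= eqxx mul1r big1 ?addr0 // => e ne.
case: eqP => [ex|_]; last by rewrite mul0r.
by case/eqP: ne; apply: val_inj.
Qed.

Lemma gstep_curve_coef q i j :
  gstep curve_coef q i j =
    shift2 k.+1 0 q i j + shift2 0 k.+1 q i j - shift2 k k q i j.
Proof.
pose F (x : nat * nat) := shift2 x.1 x.2 q i j.
rewrite -[shift2 k.+1 0 q i j]/(F (k.+1, 0%N)) -[shift2 0 k.+1 q i j]/(F (0%N, k.+1)).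
rewrite -[shift2 k k q i j]/(F (k, k)).
rewrite -!sum_fset_delta; try by apply: (fsubsetP EkE); rewrite !inE eqxx ?orbT.
rewrite -big_split -sumrB; apply: eq_bigr => e _ /=.
by rewrite -mulrDl -mulrBl.
Qed.

(** The two branches give [R(x) + S(x^k) = x^(k+1) = S(x) + R(x^k)], which forces [R = S]. *)
Lemma Rser_curve_coef n :
  Rser curve_coef n =
    (n == k.+1)%:R - (if (k %| n)%N then Rser curve_coef (n %/ k)%N else 0).
Proof.
have k_gt0 : (0 < k)%N by apply: ltnW.
have [qr _] := xy_quoremP curve_coef admE.
have [R0 S0 rE] := xy_quorem_split curve_coef admE.
set q := (xy_quorem curve_coef).1 in qr.
have eqR i j : mono2 K 1 1 i j =
     shift2 1 1 q i j - shift2 k.+1 0 q i j - shift2 0 k.+1 q i j + shift2 k k q i j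
     + ((if j == 0%N then Rser curve_coef i else 0) +
        (if i == 0%N then Sser curve_coef j else 0)).
  rewrite qr rE fps2_mul_gser gstep_curve_coef; congr (_ + _).
  by rewrite !opprD opprK !addrA.
have RS := division_on_curve k_gt0 eqR.
have SR : forall n, Sser curve_coef n +
    (if (k %| n)%N then Rser curve_coef (n %/ k)%N else 0) = (n == k.+1)%:R.
  (* The divisor is symmetric in [x] and [y], so the branch [x = y^k] is handled by transposing the
     quotient. *)
  apply: (@division_on_curve _ _ k_gt0 (fun i j => q j i)) => i j.
  have sh u v : shift2 u v (fun i j => q j i) i j = shift2 v u q j i.
    by rewrite /shift2 andbC.
  rewrite !sh /mono2 andbC -[LHS]/(mono2 K 1 1 j i) eqR; congr (_ + _ + _).
    by rewrite -!addrA; congr (_ + _); rewrite addrC.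
  by rewrite addrC.
(* Comparing both equations at [m] reduces the claim to [m / k], which is smaller; the constant
   terms are both zero. *)
have eqRS m : Rser curve_coef m = Sser curve_coef m.
  elim/ltn_ind: m => -[|m] IHm; first by rewrite R0 S0.
  have := RS m.+1; rewrite -SR; case: ifP => _; last by rewrite !addr0.
  by rewrite (IHm (m.+1 %/ k)%N) ?ltn_Pdiv // => /addIr.
by rewrite -(SR n) -eqRS addrK.
Qed.

End Specialization.

(** * Falling factorials and iterated derivatives *)

Lemma poly_eq0_nat_roots (K : numFieldType) (p : {poly K}) (N : nat -> nat) (m0 : nat) :
  injective N -> (forall m, (m0 <= m)%N -> p.[(N m)%:R] = 0) -> p = 0.
Proof.
move=> Ninj pN; apply/eqP; apply: contraT => p0.
pose rs : seq K := [seq (N m)%:R | m <- iota m0 (size p)].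
have : (size rs < size p)%N.
  apply: max_poly_roots => //.
    by apply/allP => _ /mapP[m + ->]; rewrite mem_iota => /andP[le _]; apply/rootP/pN.
  rewrite map_inj_uniq ?iota_uniq // => m n /eqP.
  by rewrite eqr_nat => /eqP/Ninj.
by rewrite size_map size_iota ltnn.
Qed.

(** The falling factorial [X (X - 1) ... (X - i + 1)], whose values are the factors produced by an
    [i]-fold derivative. *)
Definition ffact_poly (K : numFieldType) (i : nat) : {poly K} :=
  \prod_(t <- iota 0 i) ('X - t%:R%:P).

Lemma size_ffact_poly (K : numFieldType) i : size (ffact_poly K i) = i.+1.
Proof. by rewrite size_prod_XsubC size_iota. Qed.

Lemma coef_ffact_poly (K : numFieldType) i : (ffact_poly K i)`_i = 1.
Proof.
have /monicP := monic_prod_XsubC (iota 0 i) xpredT (fun t : nat => t%:R : K).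
by rewrite lead_coefE -/(ffact_poly K i) size_ffact_poly.
Qed.

Lemma horner_ffact_poly (K : numFieldType) n i :
  (ffact_poly K i).[n%:R] = (n ^_ i)%:R.
Proof.
elim: i => [|i IHi]; first by rewrite /ffact_poly big_nil hornerC.
rewrite /ffact_poly -addn1 iotaD big_cat big_seq1 /= hornerM hornerXsubC IHi.
rewrite addn1 ffactnSr natrM; case: (leqP i n) => [le|lt]; first by rewrite natrB.
by rewrite ffact_small // !mul0r.
Qed.

Lemma iter_fps_derivE (K : fieldType) (f : fps K) i n :
  iter i (@fps_deriv K) f n = f (n + i)%N *+ (n + i) ^_ i.
Proof.
elim: i n => [|i IHi] n /=; first by rewrite addn0.
rewrite /fps_deriv IHi -mulrnA addSnnS ffactnSr; congr (_ *+ (_ * _)).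
by rewrite -addSnnS addnK.
Qed.

(** * Gaps of the lacunary series against D-finiteness *)

Section Lacunary.
Variables (K : numFieldType) (k : nat) (f : fps K).
Hypothesis k_gt1 : (1 < k)%N.
Hypothesis fE :
  forall n, f n = (n == k.+1)%:R - (if (k %| n)%N then f (n %/ k)%N else 0).

(** The exponents that form the support of [f]. *)
Let N m := (k.+1 * k ^ m)%N.
Let k_gt0 : (0 < k)%N := ltnW k_gt1.

Lemma lacunary_ge m : (m < N m)%N.
Proof. by apply: leq_trans (ltn_expl m k_gt1) _; rewrite leq_pmull. Qed.

Lemma lacunary_lt m p : (m < p)%N -> (2 * N m <= N p)%N.
Proof.
move=> mp; rewrite /N mulnCA leq_mul2l /=.
apply: leq_trans (leq_pexp2l k_gt0 mp); rewrite expnS leq_mul2r k_gt1 orbT //.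
Qed.

Lemma lacunary_inj : injective N.
Proof.
move=> m p eqN; have Nm := lacunary_ge m.
by case: (ltngtP m p) => // /lacunary_lt; rewrite eqN; lia.
Qed.

Lemma lacunary_neq0 m : f (N m) != 0.
Proof.
elim: m => [|m IHm]; rewrite fE /N.
  rewrite expn0 muln1 eqxx -addn1 dvdn_addr // dvdn1.
  by rewrite gtn_eqF // subr0 oner_eq0.
rewrite expnS mulnCA dvdn_mulr // mulKn // gtn_eqF ?sub0r ?oppr_eq0 //.
by have := lacunary_lt (ltn0Sn m); rewrite /N expn0 expnS; lia.
Qed.

Lemma lacunary_supp n : f n != 0 -> exists m, n = N m.
Proof.
elim/ltn_ind: n => n IHn; have [->|nk] := eqVneq n k.+1.
  by exists 0%N; rewrite /N expn0 muln1.
rewrite fE (negPf nk) sub0r oppr_eq0; case: ifP => [kn|]; last by rewrite eqxx.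
have [n0|n0] := posnP n.
  (* At [n = 0] the functional equation reads [f 0 = - f 0], and the characteristic is zero. *)
  suff -> : f (n %/ k)%N = 0 by rewrite eqxx.
  rewrite n0 div0n; have /eqP := fE 0; rewrite dvdn0 div0n sub0r.
  by rewrite -addr_eq0 -mulr2n mulrn_eq0 => /eqP.
case/IHn => [|m nm]; first by rewrite ltn_Pdiv.
by exists m.+1; rewrite -(divnK kn) nm /N expnS mulnCA mulnC.
Qed.

(** Exponents of the support at least double from one to the next, so [N m] is the only one strictly
    between its half and its double. *)
Lemma lacunary_gap m n :
  n != N m -> (N m < 2 * n)%N -> (n < 2 * N m)%N -> f n = 0.
Proof.
move=> nm lt gt; apply/eqP; apply: contraT => /lacunary_supp[p np].
case: (ltngtP m p) => mp.
- by move: (lacunary_lt mp); lia.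
- by move: (lacunary_lt mp); lia.
- by rewrite np mp eqxx in nm.
Qed.

(* At [x^n] with [n - l + i = N m], only the pairs [(i, l)] with a fixed value
   of [i - l] contribute, each through [(N m) ^_ i]: a polynomial in [N m]. *)
Lemma lacunary_not_dfinite : ~ dfinite f.
Proof.
case=> D [a [[i1 ai1] rel]].
(* The highest derivative that occurs; it and the leading coefficient of [a i0] select the diagonal
   to inspect. *)
have [i0 ai0 imax] := @arg_maxnP _ i1 (fun i => a i != 0) (fun i => i : nat) ai1.
pose l0 := (size (a i0)).-1.
pose d := (\max_(i < D.+1) size (a i))%N.
have ad i : (size (a i) <= d)%N by apply: leq_bigmax.
have l0d : (l0 <= d)%N by apply: leq_trans (leq_pred _) (ad i0).
(* The coefficient of [a i] on the diagonal [i - l = i0 - l0]. *)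
pose b (i : 'I_D.+1) := if (i0 <= l0 + i)%N then (a i)`_(l0 + i - i0) else 0.
pose p := \sum_(i < D.+1) b i *: ffact_poly K i.
have p0 : p = 0.
  (* Past this threshold every exponent [n - l + i] with [l < d] lies between half and twice [N m],
     so the gap applies unless it equals [N m]. *)
  apply: (@poly_eq0_nat_roots _ _ N (4 * (D + d + 1)) lacunary_inj) => m mle.
  have Nm : (4 * (D + d + 1) < N m)%N by apply: leq_ltn_trans mle (lacunary_ge m).
  have i0D := ltn_ord i0.
  pose n := (N m + l0 - i0)%N.
  apply: (mulfI (lacunary_neq0 m)); rewrite mulr0 -(rel n).
  rewrite horner_sum mulr_sumr; apply: eq_bigr => i _.
  have iD := ltn_ord i.
  rewrite hornerZ horner_ffact_poly.
  have other l : (l <= n)%N -> (l + i0 != l0 + i)%N ->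
      (a i)`_l * iter i (@fps_deriv K) f (n - l)%N = 0.
    move=> ln li; rewrite iter_fps_derivE.
    have [ld|dl] := ltnP l d; last by rewrite nth_default ?mul0r // (leq_trans (ad i)).
    by rewrite (@lacunary_gap m) ?mul0rn ?mulr0 // /n; lia.
  rewrite /fps_mul /b /fps_of_poly; case: ifP => [le|gt].
    have ln : (l0 + i - i0 < n.+1)%N by rewrite /n; lia.
    rewrite (bigD1 (Ordinal ln)) //= big1 ?addr0 => [|l ll]; last first.
      apply: other; first by rewrite -ltnS.
      by apply: contraNneq ll => ll; apply/eqP/val_inj => /=; lia.
    rewrite iter_fps_derivE; have -> : (n - (l0 + i - i0) + i = N m)%N by rewrite /n; lia.
    by rewrite -[f (N m) *+ _]mulr_natr mulrCA.
  rewrite mul0r mulr0 big1 // => l _; apply: other; first by rewrite -ltnS.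
  by move: gt; lia.
(* For [i < i0] the falling factorial has degree below [i0]; for [i > i0] maximality gives
   [a i = 0]. *)
have : p`_i0 = (a i0)`_l0.
  rewrite coef_sum (bigD1 i0) //= big1 ?addr0 => [|i ii0].
    by rewrite coefZ coef_ffact_poly mulr1 /b leq_addl addnK.
  rewrite coefZ; case: (ltngtP i i0) => [lt|gt|/val_inj eq].
  - by rewrite [X in _ * X]nth_default ?mulr0 // size_ffact_poly.
  - have ai : a i = 0 by apply/eqP; apply: contraLR gt => /imax; rewrite -leqNgt.
    by rewrite /b ai !coef0 if_same mul0r.
  - by rewrite eq eqxx in ii0.
rewrite p0 coef0 => /eqP; rewrite eq_sym -lead_coefE lead_coef_eq0.
by rewrite (negPf ai0).
Qed.

End Lacunary.

(** * Annihilating polynomials of a power series *)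

Lemma dvdXn_coef (K : fieldType) (p : {poly K}) N :
  (forall n, (n < N)%N -> p`_n = 0) -> 'X^N %| p.
Proof.
move=> p0; rewrite -[p](poly_take_drop N) [take_poly N p](_ : _ = 0).
  by rewrite add0r dvdp_mull.
by apply/polyP => n; rewrite coef_take_poly coef0; case: ifP => // /p0.
Qed.

(** A polynomial agreeing with [f] below [x^N], so that [P] can be evaluated within polynomials. *)
Definition fps_trunc (K : fieldType) (f : fps K) (N : nat) : {poly K} :=
  \poly_(i < N) f i.

(* [P(x, f(x)) = 0], stated modulo every power of [x]. *)
Definition annihilates (K : fieldType) (f : fps K) (P : {poly {poly K}}) :=
  forall N, 'X^N %| P.[fps_trunc f N].

Section Annihilators.
Variables (K : fieldType) (f : fps K).

Lemma coef_fps_truncX N j n :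
  (n < N)%N -> (fps_trunc f N ^+ j)`_n = fps_exp f j n.
Proof.
elim: j n => [|j IHj] n nN; first by rewrite expr0 coef1.
rewrite exprS coefM; apply: eq_bigr => i _.
have iN : (i < N)%N by apply: leq_ltn_trans nN; rewrite -ltnS.
by rewrite coef_poly iN IHj // (leq_ltn_trans (leq_subr _ _)).
Qed.

Lemma annihilator_of_dependence D :
  poly_dependent (fun j : 'I_D => fps_exp f j) ->
  exists2 P : {poly {poly K}}, P != 0 & annihilates f P.
Proof.
case=> a [i ai] rel.
pose P := \poly_(j < D) oapp a 0 (insub j).
have PE (j : 'I_D) : P`_j = a j by rewrite coef_poly ltn_ord valK.
exists P => [|N]; first by apply: contraNneq ai => P0; rewrite -PE P0 coef0.
apply: dvdXn_coef => n nN; rewrite (horner_coef_wide _ (size_poly _ _)).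
rewrite coef_sum -[RHS](rel n); apply: eq_bigr => j _.
rewrite PE coefM; apply: eq_bigr => l _.
by rewrite coef_fps_truncX // (leq_ltn_trans (leq_subr _ _)).
Qed.

Lemma algebraic_fps_dependent :
  algebraic_fps f -> exists D, poly_dependent (fun j : 'I_D => fps_exp f j).
Proof.
case=> P P0 rel; exists (size P), (fun j => P`_j) => //.
have lt : ((size P).-1 < size P)%N by rewrite prednK // lt0n size_poly_eq0.
by exists (Ordinal lt); rewrite /= -lead_coefE lead_coef_eq0.
Qed.

Lemma annihilatesZ (c : {poly K}) P : annihilates f P -> annihilates f (c *: P).
Proof. by move=> Pf N; rewrite hornerZ dvdp_mull. Qed.

Lemma annihilatesB P Q :
  annihilates f P -> annihilates f Q -> annihilates f (P - Q).
Proof. by move=> Pf Qf N; rewrite hornerD hornerN dvdp_sub. Qed.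

End Annihilators.

(** * The top two coefficients of powers of [c - X] *)

Section NegatedPowers.
Variables (R : idomainType) (c : R).

Lemma size_CsubXn j : (size ((c%:P - 'X) ^+ j)%R <= j.+1)%N.
Proof.
apply: leq_trans (size_poly_exp_leq _ _) _; rewrite ltnS.
have : (size (c%:P - 'X)%R <= 2)%N.
  by rewrite (leq_trans (size_polyD _ _)) // size_polyN size_polyX geq_max size_polyC; case: eqP.
by move=> le; rewrite -[leqRHS]mul1n leq_mul2r; apply/orP; right; case: size le => // -[|[]].
Qed.

Lemma coef_CsubXn j : ((c%:P - 'X) ^+ j)`_j = (-1) ^+ j.
Proof.
elim: j => [|j IHj]; first by rewrite !expr0 coef1.
rewrite exprS mulrBl coefB coefCM coefXM /= IHj nth_default ?size_CsubXn //.
by rewrite mulr0 sub0r exprS mulN1r.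
Qed.

Lemma coef_CsubXnS j :
  ((c%:P - 'X) ^+ j.+1)`_j = (-1) ^+ j * (c *+ j.+1).
Proof.
elim: j => [|j IHj]; first by rewrite expr1 coefB coefC coefX subr0 expr0 mul1r.
rewrite exprS mulrBl coefB coefCM coefXM /= IHj coef_CsubXn.
by rewrite [c *+ j.+2]mulrS mulrDr [(-1) ^+ j.+1]exprS !mulN1r mulrC !mulNr.
Qed.

End NegatedPowers.

(** * Transcendence from the functional equation *)

Section LacunaryTranscendental.
Variables (K : numFieldType) (k : nat) (f : fps K).
Hypothesis k_gt1 : (1 < k)%N.
Hypothesis fE :
  forall n, f n = (n == k.+1)%:R - (if (k %| n)%N then f (n %/ k)%N else 0).

Let k_gt0 : (0 < k)%N := ltnW k_gt1.

(* [P(x^k, x^(k+1) - T)] *)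
Definition mahler_transform (P : {poly {poly K}}) : {poly {poly K}} :=
  \sum_(j < size P) (P`_j \Po 'X^k) *: (('X^(k.+1))%:P - 'X) ^+ j.

(** Since [x^(k+1) - f(x) = f(x^k)], the transform evaluated at [f] is [P(x, f(x))] with [x^k]
    substituted for [x]. Truncation makes this a congruence modulo [x^M]. *)
Lemma annihilates_mahler P : annihilates f P -> annihilates f (mahler_transform P).
Proof.
move=> Pf M; set t := fps_trunc f M.
pose s := 'X^(k.+1) - t; pose s' := t \Po 'X^k.
have ss' : 'X^M %| s - s'.
  apply: dvdXn_coef => n nM; rewrite !coefB coefXn coef_comp_poly_Xn // !coef_poly nM.
  rewrite fE; case: ifP => _; last by rewrite !subr0 subrr.
  by rewrite (leq_ltn_trans (leq_div _ _)) // opprB addrCA subrr addr0 subrr.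
have -> : (mahler_transform P).[t] = \sum_(j < size P) (P`_j \Po 'X^k) * s ^+ j.
  rewrite horner_sum; apply: eq_bigr => j _.
  by rewrite hornerZ horner_exp hornerD hornerN hornerX hornerC.
have P' : \sum_(j < size P) (P`_j \Po 'X^k) * s' ^+ j = P.[t] \Po 'X^k.
  rewrite horner_coef rmorph_sum /=; apply: eq_bigr => j _.
  by rewrite rmorphM rmorphXn.
rewrite -[X in _ %| X](subrK (P.[t] \Po 'X^k)) dvdp_add //.
  rewrite -P' -sumrB; apply: (big_ind (fun p : {poly K} => 'X^M %| p)) => [|x y|j _]; rewrite ?dvdp0 //.
    exact: dvdp_add.
  (* [s - s'] divides the difference of the [j]-th powers. *)
  by rewrite -mulrBr dvdp_mull // subrXX dvdp_mulr.
have /dvdpP[q ->] := Pf M.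
rewrite rmorphM rmorphXn /= comp_polyX dvdp_mull // -exprM dvdp_exp2l //.
by rewrite leq_pmull.
Qed.

Lemma size_mahler P : (size (mahler_transform P) <= size P)%N.
Proof.
apply: leq_trans (size_sum _ _ _) _; apply/bigmax_leqP => j _.
by apply: leq_trans (size_scale_leq _ _) _; apply: leq_trans (size_CsubXn _ _) _.
Qed.

Lemma coef_mahler (P : {poly {poly K}}) e : size P = e.+1 ->
  (mahler_transform P)`_e = (-1) ^+ e * (P`_e \Po 'X^k).
Proof.
move=> sP; rewrite /mahler_transform sP big_ord_recr /= coefD coef_sum big1 ?add0r.
  by rewrite coefZ coef_CsubXn mulrC.
by move=> j _; rewrite coefZ [X in _ * X]nth_default ?mulr0 //; apply: leq_trans (size_CsubXn _ _) _.
Qed.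

Lemma coef_mahlerS (P : {poly {poly K}}) e : size P = e.+2 ->
  (mahler_transform P)`_e =
    (-1) ^+ e * ((P`_e.+1 \Po 'X^k) * ('X^(k.+1) *+ e.+1) + (P`_e \Po 'X^k)).
Proof.
move=> sP; rewrite /mahler_transform sP 2!big_ord_recr /= !coefD coef_sum big1 ?add0r.
  by rewrite !coefZ coef_CsubXn coef_CsubXnS addrC mulrDr mulrCA [in X in _ + X]mulrC.
by move=> j _; rewrite coefZ [X in _ * X]nth_default ?mulr0 //; apply: leq_trans (size_CsubXn _ _) _.
Qed.

(* With [g = - w / v], this says that [g(x) + g(x^k) = c x^(k+1)] has no rational solution. *)
Lemma no_rational_mahler_solution (v w : {poly K}) (c : nat) : v != 0 -> (0 < c)%N ->
  (v \Po 'X^k) * w + v * (w \Po 'X^k) <> - (v * (v \Po 'X^k) * ('X^(k.+1) *+ c)).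
Proof.
move=> v0 c0 eqvw.
have szk (p : {poly K}) : p != 0 -> p \Po 'X^k != 0 /\ size (p \Po 'X^k) = (k * (size p).-1).+1.
  move=> p0; have pk0 : p \Po 'X^k != 0.
    by rewrite -size_poly_eq0 -lt0n lt0n size_poly_eq0 comp_poly_eq0 // size_polyXn.
  split=> //; rewrite -[LHS]prednK ?lt0n ?size_poly_eq0 //.
  by rewrite size_comp_poly size_polyXn mulnC.
have [vk0 svk] := szk v v0.
have sv : size v = (size v).-1.+1 by rewrite prednK // lt0n size_poly_eq0.
have sR : size (- (v * (v \Po 'X^k) * ('X^(k.+1) *+ c))) =
    ((size v).-1 + k * (size v).-1 + k.+1).+1.
  rewrite size_polyN -scaler_nat -scalerAr size_scale ?pnatr_eq0 -?lt0n //.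
  by rewrite size_mulXn ?mulf_neq0 // size_mul // svk sv /=; lia.
have := congr1 (fun p : {poly K} => size p) eqvw; rewrite sR.
have [->|w0] := eqVneq w 0; first by rewrite mulr0 comp_poly0 mulr0 addr0 size_poly0.
have [wk0 swk] := szk w w0.
have sw : size w = (size w).-1.+1 by rewrite prednK // lt0n size_poly_eq0.
have s1 : size ((v \Po 'X^k) * w) = (k * (size v).-1 + (size w).-1).+1.
  by rewrite size_mul // svk {1}sw; lia.
have s2 : size (v * (w \Po 'X^k)) = ((size v).-1 + k * (size w).-1).+1.
  by rewrite size_mul // swk {1}sv; lia.
(* If [deg w <= deg v], the right side has larger degree than both terms on the left. Otherwise the
   second term dominates because [k > 1], and equal degrees give [k (deg w - deg v) = k + 1], which
   is impossible. *)
have [le|gt] := leqP (size w).-1 (size v).-1.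
  move=> eqs; have := size_polyD ((v \Po 'X^k) * w) (v * (w \Po 'X^k)).
  by rewrite eqs s1 s2 leq_max; nia.
rewrite addrC size_polyDl ?s1 ?s2; last by nia.
move=> eqs; have [r rE] : exists r, (size w).-1 = ((size v).-1 + r)%N.
  by exists ((size w).-1 - (size v).-1)%N; rewrite subnKC // ltnW.
have : (k * r = k.+1)%N by move: eqs; rewrite rE mulnDr; lia.
by case: r {rE} => [|[|r]]; rewrite ?muln0 ?muln1 //; nia.
Qed.

(** Descent on the degree in [T]: cancelling the top terms of [P] and its transform leaves a smaller
    annihilator, so the two are proportional. *)
Lemma lacunary_no_annihilator P : annihilates f P -> P = 0.
Proof.
have [n] := ubnP (size P); elim: n P => // n IHn P sP Pf.
apply/eqP; apply: contraT => P0; exfalso.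
case sPE : (size P) => [|[|e]]; first by move/eqP: sPE; rewrite size_poly_eq0 (negPf P0).
  have /size_poly1P[c c0 PE] : size P == 1%N by rewrite sPE.
  (* A non-zero [c] free of [T] cannot be divisible by a power of [x] exceeding its degree. *)
  have := Pf (size c); rewrite PE hornerC => /(dvdp_leq c0).
  by rewrite size_polyXn ltnn.
pose Q := mahler_transform P.
pose M := Q`_e.+1 *: P - P`_e.+1 *: Q.
have Qf : annihilates f Q by apply: annihilates_mahler.
have M0 : M = 0.
  apply: IHn; last by apply: annihilatesB; apply: annihilatesZ.
  rewrite -ltnS; apply: leq_trans sP; rewrite sPE !ltnS; apply/leq_sizeP => j ej.
  rewrite coefB !coefZ; have [->|je] := eqVneq j e.+1; first by rewrite mulrC subrr.
  have ltj : (size P <= j)%N by rewrite sPE ltn_neqAle eq_sym je.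
  rewrite (nth_default _ ltj) [Q`_j]nth_default ?mulr0 ?subrr //.
  exact: leq_trans (size_mahler _) ltj.
have v0 : P`_e.+1 != 0 by rewrite -[e.+1]/(e.+2.-1) -sPE -lead_coefE lead_coef_eq0.
apply: (@no_rational_mahler_solution (P`_e.+1) (P`_e) e.+1 v0) => //.
(* The coefficient of [T^e] in [M = 0] is, up to sign, the excluded equation with [v] and [w] the
   top two coefficients of [P]. *)
have := congr1 (fun p : {poly {poly K}} => p`_e) M0.
rewrite coefB !coefZ coef0 /Q (coef_mahler sPE) (coef_mahlerS sPE).
move/eqP; rewrite subr_eq0 => /eqP.
set vk := _ \Po _; set wk := _ \Po _; set v := P`_e.+1; set w := P`_e.
rewrite -!mulrA exprS mulN1r !mulNr [v * (_ * _)]mulrCA -mulrN.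
move/(mulfI (negbT (signr_eq0 _ e))) => eq.
have eq' : vk * w = - (v * (vk * ('X^(k.+1) *+ e.+1) + wk)) by rewrite -eq opprK.
by rewrite eq' mulrDr opprD subrK mulrA.
Qed.

End LacunaryTranscendental.

Theorem proposition11p3 (R : realType) (E : {fset nat * nat})
    (hE : admissible E) (k : nat) (hk : (1 < k)%N) (hEk : (Ek k `<=` E)%fset)
    (alpha : E -> R[i]) (halpha : alg_independent_Q alpha) :
  ~ dfinite (Rser alpha) /\ ~ algebraic_fps (Rser alpha).
Proof.
have curveE := Rser_curve_coef R[i] hE hk hEk.
have polyR := ratpolyfun_Rser R[i] hE.
split=> [[D [a [a0 rel]]]|/algebraic_fps_dependent[D dep]].
  apply: (lacunary_not_dfinite hk curveE).
  pose B c (i : 'I_D.+1) := iter i (@fps_deriv R[i]) (@Rser R[i] E c).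
  (* Differentiation only shifts coefficients and multiplies them by integers. *)
  have polyB i n : ratpolyfun (fun c => B c i n).
    apply: ratpolyfun_ext (ratpolyfunM (polyR (n + i)%N) (ratpolyfun_nat _ _ ((n + i) ^_ i))).
    by move=> c; rewrite /B iter_fps_derivE mulr_natr.
  have [|b b0 relb] := poly_dependent_specialization (curve_coef R[i] k) halpha polyB.
    by exists a.
  by exists D, b.
pose B c (j : 'I_D) := fps_exp (@Rser R[i] E c) j.
have polyB j n : ratpolyfun (fun c => B c j n) by apply: ratpolyfun_fps_exp.
have := poly_dependent_specialization (curve_coef R[i] k) halpha polyB dep.
case/annihilator_of_dependence => P P0 /(lacunary_no_annihilator hk curveE) P0'.
by rewrite P0' eqxx in P0.
Qed.
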